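(* For every integer $n\ge1$, let $\mathrm{Peak}_{\mathcal N_2(n)}(t)=\sum t^{\mathrm{peak}(\mathbf a)}$, the sum being over all area sequences $\mathbf a$ of size $n$ with $\mathrm{pnest}(\mathbf a)\le2$, and let $\gamma_{\mathcal N_2(n)}(t)$ be the gamma-polynomial of the symmetric polynomial $\mathrm{Peak}_{\mathcal N_2(n)}(t)/t$. Then $$\gamma_{\mathcal N_2(n)}(t)=\sum_{i=0}^{\lfloor\frac{n-1}{2}\rfloor}\binom{n-1}{2i}t^i=\frac{(1+\sqrt t)^{n-1}+(1-\sqrt t)^{n-1}}{2}.$$ Moreover, $\binom{n-1}{2i}$ is the number of Motzkin paths of length $n-1$ with $i$ $U$ steps and height at most $1$ (equivalently, the number of Motzkin sequences of size $n$ with $i$ ascents whose largest entry is at most $2$).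
   Context: Write $[n]=\{1,\dots,n\}$. An area sequence of size $n$ is a sequence $\mathbf a=(a_1,\dots,a_n)$ of nonnegative integers with $a_i<i$ for all $i$ and $a_i\le a_{i-1}+1$ for all $i\ge 2$. It defines a graph $\Gamma_{\mathbf a}$ (a unit interval graph) on $[n]$ with edges $\{j,i\}$ for $1\le j<i\le n$ with $i-a_i\le j$. If $\{i,j\}$ with $i<j$ is an edge then $\{i,i+1,\dots,j\}$ is a clique. A peak-edge of $\Gamma_{\mathbf a}$ is either an isolated vertex $i$ (put $j=i$) or an edge $\{i,j\}$, $i<j$, such that neither $\{i,j+1\}$ nor $\{i-1,j\}$ is an edge (pairs not contained in $[n]$ are not edges). The corresponding peak-clique is $\{i,\dots,j\}$. The number of peak-edges is $\mathrm{peak}(\mathbf a)$. The peak-nesting of a vertex is the number of peak-cliques containing it, and $\mathrm{pnest}(\mathbf a)$ is the maximum over all vertices. A polynomial $p(t)$ of degree $d$ is symmetric if $p(t)=t^dp(1/t)$; then $p(t)=\sum_{0\le 2i\le d}\gamma_it^i(1+t)^{d-2i}$ uniquely and $\gamma_p(t)=\sum_i\gamma_it^i$ is its gamma-polynomial. A Motzkin path of length $m$ is a lattice path from $(0,0)$ to $(m,0)$ with steps $U=(1,1)$, $D=(1,-1)$, $H=(1,0)$ never going below the $x$-axis; its height is the largest $y$-coordinate attained. A Motzkin sequence of size $n$ is a sequence $(w_1,\dots,w_n)$ of positive integers with $w_1=w_n=1$ and $|w_i-w_{i+1}|\le1$; an ascent is an index $i\in[n-1]$ with $w_i<w_{i+1}$.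 *)

(* Defs.v *)
From HB Require Import structures.
From mathcomp Require Import all_boot all_order all_algebra.

Set Implicit Arguments.
Unset Strict Implicit.
Unset Printing Implicit Defensive.

Import Order.TTheory GRing.Theory Num.Theory.

(* The vertex set {1, ..., n} is 'I_n, the ordinal i standing for vertex i + 1.
   A condition comparing two vertices is unchanged by this shift, whereas
   a_i < i becomes a i <= i; it also makes 'I_n a sufficient codomain. *)
Definition area_seq (n : nat) (a : {ffun 'I_n -> 'I_n}) : bool :=
  [forall i : 'I_n, a i <= i]
  && [forall i : 'I_n, forall j : 'I_n, (j == i.+1 :> nat) ==> (a j <= (a i).+1)].

(* For j < i, the condition i - a_i <= j is written i <= j + a_i. *)
Definition uig_edge (n : nat) (a : {ffun 'I_n -> 'I_n}) : rel 'I_n :=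
  [rel i j : 'I_n | (i < j) && (j <= i + a j) || (j < i) && (i <= j + a i)].

Definition is_peak_edge (n : nat) (a : {ffun 'I_n -> 'I_n})
    (e : 'I_n * 'I_n) : bool :=
  let: (i, j) := e in
  (i == j) && [forall k, ~~ uig_edge a i k]
  || [&& i < j, uig_edge a i j,
         [forall k : 'I_n, (k == j.+1 :> nat) ==> ~~ uig_edge a i k]
       & [forall k : 'I_n, (k.+1 == i :> nat) ==> ~~ uig_edge a k j]].

Definition peak_edges (n : nat) (a : {ffun 'I_n -> 'I_n}) :
    {set 'I_n * 'I_n} :=
  [set e | is_peak_edge a e].

Definition peak_clique (n : nat) (e : 'I_n * 'I_n) : {set 'I_n} :=
  [set k : 'I_n | e.1 <= k <= e.2].

Definition peak_cliques (n : nat) (a : {ffun 'I_n -> 'I_n}) :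
    {set {set 'I_n}} :=
  [set peak_clique e | e in peak_edges a].

Definition peak (n : nat) (a : {ffun 'I_n -> 'I_n}) : nat := #|peak_edges a|.

Definition peak_nesting (n : nat) (a : {ffun 'I_n -> 'I_n}) (v : 'I_n) : nat :=
  #|[set C in peak_cliques a | v \in C]|.

Definition pnest (n : nat) (a : {ffun 'I_n -> 'I_n}) : nat :=
  \max_(v < n) peak_nesting a v.

Definition peak_family (k n : nat) : {set {ffun 'I_n -> 'I_n}} :=
  [set a | area_seq a && (pnest a <= k)].

Definition peak_poly (k n : nat) : {poly int} :=
  (\sum_(a in peak_family k n) 'X^(peak a))%R.

Section Gamma.
Local Open Scope ring_scope.

Definition poly_deg (R : nzRingType) (p : {poly R}) : nat := (size p).-1.

(* The right-hand side is t ^ d * p (1 / t), where d is the degree of p. *)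
Definition symmetric_poly (R : nzRingType) (p : {poly R}) : Prop :=
  p = \poly_(i < (poly_deg p).+1) p`_(poly_deg p - i).

Definition is_gamma_poly (R : nzRingType) (p g : {poly R}) : Prop :=
  (size g <= (poly_deg p)./2.+1)%N /\
  p = \sum_(i < (poly_deg p)./2.+1)
        g`_i *: ('X^i * (1 + 'X) ^+ (poly_deg p - i.*2)).

Lemma gamma_expansion_inj (R : nzRingType) (d m : nat) (c : nat -> R) :
  \sum_(i < m) c i *: ('X^i * (1 + 'X) ^+ (d - i.*2)) = 0 ->
  forall i, (i < m)%N -> c i = 0.
Proof.
move=> c0 i; elim/ltn_ind: i => i IH lt_im.
have := congr1 (coefp i) c0; rewrite /coefp coef0 coef_sum.
rewrite (bigD1 (Ordinal lt_im)) //= coefZ coefXnM ltnn subnn.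
rewrite big1 ?addr0 => [|[j lt_jm] /= /eqP neq_ji].
  rewrite -horner_coef0 (_ : _.[0] = 1) ?mulr1 //.
  elim: (d - _)%N => [|k IHk]; first by rewrite expr0 hornerC.
  by rewrite exprSr mulrDr mulr1 hornerD hornerMX mulr0 addr0.
rewrite coefZ coefXnM; case: ltngtP => [|lt_ji|eq_ij]; first by rewrite mulr0.
  by rewrite (IH _ lt_ji lt_jm) mul0r.
by case: neq_ji; apply: val_inj; rewrite /= eq_ij.
Qed.

Lemma gamma_poly_uniq (R : nzRingType) (p g h : {poly R}) :
  is_gamma_poly p g -> is_gamma_poly p h -> g = h.
Proof.
case=> szg Eg [szh Eh]; apply/polyP=> i; apply/eqP; rewrite -subr_eq0; apply/eqP.
have [lt_i|ge_i] := ltnP i (poly_deg p)./2.+1; last first.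
  by rewrite !nth_default ?subrr // (leq_trans _ ge_i).
apply: (gamma_expansion_inj (d := poly_deg p) (c := fun i => g`_i - h`_i) _ lt_i).
under eq_bigr do rewrite scalerBl.
by rewrite sumrB -Eg -Eh subrr.
Qed.

End Gamma.

Inductive motzkin_step := Up | Down | Horiz.

Definition ord_of_step (s : motzkin_step) : 'I_3 :=
  inord (match s with Up => 0 | Down => 1 | Horiz => 2 end).
Definition step_of_ord (i : 'I_3) : motzkin_step :=
  match val i with 0 => Up | 1 => Down | _ => Horiz end.
Lemma ord_of_stepK : cancel ord_of_step step_of_ord.
Proof. by case; rewrite /step_of_ord /ord_of_step /= inordK. Qed.
HB.instance Definition _ := Finite.copy motzkin_step (can_type ord_of_stepK).

Definition step_dy (s : motzkin_step) : int :=
  match s with Up => 1%R | Down => (- 1)%R | Horiz => 0%R end.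

(* A lattice path is given by its steps; [path_y s k] is the y-coordinate of
   its k-th point, the point for k = 0 being the origin. *)
Definition path_y (s : seq motzkin_step) (k : nat) : int :=
  (\sum_(x <- take k s) step_dy x)%R.

Definition motzkin_path (m : nat) (s : m.-tuple motzkin_step) : bool :=
  [forall k : 'I_m.+1, (0 <= path_y s k)%R] && (path_y s m == 0%R).

Definition path_height (m : nat) (s : m.-tuple motzkin_step) : int :=
  \big[Order.max/0%R]_(k < m.+1) path_y s k.

Definition up_steps (m : nat) (s : m.-tuple motzkin_step) : nat :=
  count_mem Up s.

(* The term w_i is [nth 0 w i.-1]. *)
Definition motzkin_seq (n : nat) (w : seq nat) : bool :=
  [&& size w == n, all (fun x => 0 < x) w,
      nth 0 w 0 == 1, nth 0 w n.-1 == 1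
    & [forall i : 'I_n.-1, (`|nth 0%N w i - nth 0%N w i.+1| <= 1)%N]].

Definition ascents (n : nat) (w : seq nat) : nat :=
  #|[set i : 'I_n.-1 | nth 0 w i < nth 0 w i.+1]|.

Definition largest_entry (w : seq nat) : nat := \max_(x <- w) x.

(* Justifies counting Motzkin sequences of size n among the tuples with
   entries in 'I_n.+1. *)
Lemma motzkin_seq_bound (n : nat) (w : seq nat) :
  motzkin_seq n w -> all (fun x => x < n.+1) w.
Proof.
case/and5P=> /eqP szw _ /eqP w0 _ /forallP step.
apply/(all_nthP 0) => i; rewrite szw => lt_in.
suff: nth 0 w i <= i.+1 by move/leq_ltn_trans; apply.
elim: i lt_in => [|i IH] lt_in; first by rewrite w0.
have lt_i : i < n.-1 by rewrite -ltnS (ltn_predK lt_in).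
have := step (Ordinal lt_i); rewrite /= distnC => le1.
have := leqD_dist (nth 0 w i.+1) (nth 0 w i) 0.
rewrite !distn0 => /leq_trans; apply.
exact: (leq_add le1 (IH (ltnW lt_in))).
Qed.

Definition motzkin_seqs (n : nat) : {set n.-tuple 'I_n.+1} :=
  [set w : n.-tuple 'I_n.+1 | motzkin_seq n (map val w)].

(* Main.v *)
(* A vertex lies in three peak-cliques iff some i has two weak descents
   a_(j+1) <= a_j at positions k < j < i with i - a_i <= k; so pnest <= 2 can be
   checked from left to right. After a prefix, the next entry either increases
   by 1, or is 0, or is one of e positive values, where e is the minimum of the
   current entry and the distance to the last weak descent; these choices
   change e into e + 1, 0 and 1 respectively, and the last two create a peak.
   Hence the generating function of the continuations of length m satisfies
     G_(m+1)(e) = G_m(e + 1) + t (G_m(0) + e G_m(1)),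
   whose solution is affine in e: G_m(e) = A_m + e t B_m with
     A_(m+1) = (1 + t) A_m + t B_m,  B_(m+1) = (1 + t) B_m + A_m.
   These are the recursions of the even and odd parts of (1 + t + sqrt t)^m
   with respect to sqrt t, whence the gamma expansion of A_(n-1). *)
Require Import Defs.
From HB Require Import structures.
From mathcomp Require Import all_boot all_order all_algebra.
From mathcomp Require Import zify ring.

Set Implicit Arguments.
Unset Strict Implicit.
Unset Printing Implicit Defensive.

Import Order.TTheory GRing.Theory Num.Theory.

(** * Sums over tuples, split at the first letter *)

Lemma big_tuple_cons (R : Type) (idx : R) (op : Monoid.com_law idx)
    (T : finType) (m : nat) (F : m.+1.-tuple T -> R) :
  \big[op/idx]_(s : m.+1.-tuple T) F s
  = \big[op/idx]_(x : T) \big[op/idx]_(s : m.-tuple T) F [tuple of x :: s].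
Proof.
rewrite pair_big /=.
rewrite (reindex (fun p : T * m.-tuple T => [tuple of p.1 :: p.2])) //=.
exists (fun s => (thead s, [tuple of behead s])) => [[x s] _|s _] /=.
  by congr pair; apply: val_inj.
by rewrite -tuple_eta.
Qed.

Lemma big_tuple0 (R : Type) (idx : R) (op : Monoid.com_law idx)
    (T : finType) (F : 0.-tuple T -> R) :
  \big[op/idx]_(s : 0.-tuple T) F s = F [tuple].
Proof.
by rewrite (big_pred1 [tuple]) // => s; rewrite [s]tuple0 /= eqxx.
Qed.

(** * Even and odd parts of a binomial power *)

Section EvenOddParts.
Local Open Scope ring_scope.
Variables (R : comNzRingType) (x y : R).

(* The even and odd parts of (y + sqrt x)^m, see [binomial_even_odd]; terms with
   a truncated exponent have coefficient 0. *)
Definition even_part (m : nat) : R :=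
  \sum_(i < m./2.+1) 'C(m, 2 * i)%:R * (x ^+ i * y ^+ (m - 2 * i)).

Definition odd_part (m : nat) : R :=
  \sum_(i < m./2.+1) 'C(m, (2 * i).+1)%:R * (x ^+ i * y ^+ (m - (2 * i).+1)).

(** The added binomials vanish; a common range for [m] and [m.+1] lets the recursions be checked
    term by term. *)
Lemma even_part_widen (m N : nat) : (m < N.*2)%N ->
  even_part m = \sum_(i < N) 'C(m, 2 * i)%:R * (x ^+ i * y ^+ (m - 2 * i)).
Proof.
move=> ltmN; have leN : (m./2.+1 <= N)%N by lia.
rewrite /even_part (big_ord_widen N (fun i =>
  'C(m, 2 * i)%:R * (x ^+ i * y ^+ (m - 2 * i)))) //.
rewrite big_mkcond; apply: eq_bigr => i _; case: ifP => // /negbT h.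
by rewrite bin_small ?mul0r //; lia.
Qed.

Lemma odd_part_widen (m N : nat) : (m < N.*2)%N ->
  odd_part m
  = \sum_(i < N) 'C(m, (2 * i).+1)%:R * (x ^+ i * y ^+ (m - (2 * i).+1)).
Proof.
move=> ltmN; have leN : (m./2.+1 <= N)%N by lia.
rewrite /odd_part (big_ord_widen N (fun i =>
  'C(m, (2 * i).+1)%:R * (x ^+ i * y ^+ (m - (2 * i).+1)))) //.
rewrite big_mkcond; apply: eq_bigr => i _; case: ifP => // /negbT h.
by rewrite bin_small ?mul0r //; lia.
Qed.

Lemma bin_mul_exp (m k : nat) :
  'C(m, k)%:R * y ^+ (m.+1 - k) = y * ('C(m, k)%:R * y ^+ (m - k)).
Proof.
have [lekm|ltmk] := leqP k m; first by rewrite subSn // exprS mulrCA.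
by rewrite bin_small // !mul0r mulr0.
Qed.

Lemma odd_partS (m : nat) : odd_part m.+1 = y * odd_part m + even_part m.
Proof.
rewrite (@odd_part_widen _ m.+2) 1?(@odd_part_widen m m.+2); try lia.
rewrite (@even_part_widen m m.+2); last lia.
rewrite mulr_sumr -big_split; apply: eq_bigr => i _ /=.
rewrite binS natrD mulrDl subSS; congr (_ + _).
by rewrite mulrCA -{1}[(m - 2 * i)%N]subSS bin_mul_exp; ring.
Qed.

Lemma even_partS (m : nat) : even_part m.+1 = y * even_part m + x * odd_part m.
Proof.
(* The even sums get one term more because their term at 0 is split off next; Pascal's rule then
   pairs even index [i.+1] with odd index [i]. *)
rewrite (@even_part_widen _ m.+3) 1?(@even_part_widen m m.+3); try lia.
rewrite (@odd_part_widen m m.+2); last lia.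
rewrite big_ord_recl [in RHS]big_ord_recl mulrDr -addrA; congr (_ + _).
  by rewrite muln0 !bin0 !subn0 exprS; ring.
rewrite !mulr_sumr -big_split; apply: eq_bigr => i _ /=.
rewrite /bump /= (_ : (2 * (1 + i))%N = (2 * i).+2); last lia.
rewrite binS natrD mulrDl; congr (_ + _).
  by rewrite mulrCA bin_mul_exp; ring.
by rewrite subSS add1n exprS; ring.
Qed.

Lemma even_odd_part0 : even_part 0 = 1 /\ odd_part 0 = 0.
Proof.
by rewrite /even_part /odd_part !big_ord1 /= !bin0 !mul1r bin_small ?mul0r.
Qed.

End EvenOddParts.

(** The two recursions together describe multiplication by [y + s]; writing [x] as [s ^+ 2] avoids
    square roots. *)
Lemma binomial_even_odd (R : comNzRingType) (s y : R) (m : nat) :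
  ((y + s) ^+ m = even_part (s ^+ 2) y m + s * odd_part (s ^+ 2) y m)%R.
Proof.
elim: m => [|m IH].
  by have [-> ->] := even_odd_part0 (s ^+ 2) y; rewrite mulr0 addr0.
by rewrite exprS IH even_partS odd_partS; ring.
Qed.

(** * Left-to-right test for peak-nesting at most 2 *)

(* [a] is the entry before [s] and [c] its distance to the last weak descent. *)
Fixpoint few_overlaps (a c : nat) (s : seq nat) : bool :=
  if s is x :: s' then
    if x == a.+1 then few_overlaps x c.+1 s'
    else (x <= minn a c) && few_overlaps x 1 s'
  else true.

Fixpoint weak_descents (a : nat) (s : seq nat) : nat :=
  if s is x :: s' then (x <= a) + weak_descents x s' else 0.

(* The second clause is the third one for a virtual weak descent at position
   [- c]; for [c = 1] it is vacuous on area sequences. *)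
Definition two_nested (c : nat) (w : seq nat) : Prop :=
  [/\ forall i, i.+1 < size w -> nth 0 w i.+1 <= (nth 0 w i).+1,
      forall i j, j < i < size w -> nth 0 w j.+1 <= nth 0 w j ->
        nth 0 w i < i + c
    & forall i j k, k < j < i -> i < size w ->
        nth 0 w k.+1 <= nth 0 w k -> nth 0 w j.+1 <= nth 0 w j ->
        k + nth 0 w i < i].

Lemma nth_slope (w : seq nat) (i j : nat) :
  (forall i, i.+1 < size w -> (nth 0 w i.+1 <= (nth 0 w i).+1)) ->
  i <= j < size w -> nth 0 w j <= nth 0 w i + (j - i).
Proof.
move=> slope; elim: j => [|j IH] h; first by case: i h => //=; lia.
have [->|neq] := eqVneq i j.+1; first by lia.
by have := slope j; have := IH ltac:(lia); lia.
Qed.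

(** Dropping the first entry shifts positions by one. After an increase the virtual weak descent
    moves from [- c] to [- c.+1]; otherwise the descent at position 0 replaces it, now at [- 1], and
    the third clause with [k = 0] becomes the second clause of the tail. *)
Lemma few_overlapsP (a c : nat) (s : seq nat) :
  reflect (two_nested c (a :: s)) (few_overlaps a c s).
Proof.
elim: s a c => [|x s IH] a c /=.
  by left; split=> [i|i j|i j k] /=; lia.
case: eqVneq => [->|neq].
  apply: (iffP (IH _ _)) => -[A B C]; split.
  - by case=> [|i] //= h; apply: A.
  - case=> [|i] [|j] //= h D; first by lia.
    by have := B i j; simpl in *; lia.
  - case=> [|i] [|j] [|k] //= h1 h2 D1 D2; try lia.
    by have := C i j k; simpl in *; lia.
  - by move=> i h; apply: (A i.+1).
  - by move=> i j h D; have := B i.+1 j.+1; simpl in *; lia.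
  - by move=> i j k h1 h2 D1 D2; have := C i.+1 j.+1 k.+1; simpl in *; lia.
apply: (iffP andP) => [[le_x /IH [A B C]]|[A B C]].
  have A' i : i.+1 < size [:: a, x & s] ->
      nth 0 [:: a, x & s] i.+1 <= (nth 0 [:: a, x & s] i).+1.
    by case: i => [|i] //= h; [lia|apply: A].
  split=> //.
    (* Slopes of at most 1 carry the bound [x <= c] on to all later entries. *)
    move=> i j h D; have := @nth_slope _ 1 i A'; simpl in *; lia.
  case=> [|i] [|j] [|k] //= h1 h2 D1 D2; try lia.
    by have := B i j; simpl in *; lia.
  by have := C i j k; simpl in *; lia.
have le_xa : x <= a by have := A 0; simpl in *; lia.
split; first by have := B 1 0; simpl in *; lia.
apply/IH; split.
- by move=> i h; apply: (A i.+1).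
- by move=> i j h D; have := C i.+1 j.+1 0; simpl in *; lia.
- by move=> i j k h1 h2 D1 D2; have := C i.+1 j.+1 k.+1; simpl in *; lia.
Qed.

Lemma weak_descentsE (a : nat) (s : seq nat) :
  weak_descents a s
  = \sum_(j < size s) (nth 0 (a :: s) j.+1 <= nth 0 (a :: s) j).
Proof.
elim: s a => [|x s IH] a; first by rewrite big_ord0.
by rewrite big_ord_recl /= IH.
Qed.

(** * Generating function by weak descents *)

Section DescentPoly.
Local Open Scope ring_scope.
Variable R : comNzRingType.
Local Notation Ev := (even_part ('X : {poly R}) (1 + 'X)).
Local Notation Od := (odd_part ('X : {poly R}) (1 + 'X)).

(* The remaining terms see only the number [minn a c] of admissible positive
   values after a weak descent, and depend on it affinely. *)
Lemma few_overlaps_gf (N m a c : nat) : (a + m < N)%N -> (0 < c)%N ->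
  \sum_(s : m.-tuple 'I_N | few_overlaps a c (map (@nat_of_ord N) s))
     'X^(weak_descents a (map (@nat_of_ord N) s))
  = Ev m + 'X * Od m *+ minn a c :> {poly R}.
Proof.
elim: m a c => [|m IH] a c lt_N c_gt0; rewrite big_mkcond.
  rewrite big_tuple0 /= expr0.
  have [-> ->] := even_odd_part0 ('X : {poly R}) (1 + 'X).
  by rewrite mulr0 mul0rn addr0.
rewrite big_tuple_cons.
pose G e : {poly R} := Ev m + 'X * Od m *+ e.
(* After a weak descent to [x] the distance is 1, so the new parameter [minn x 1] is 0 or 1, and one
   factor ['X] is gained. *)
transitivity (\sum_(x < N) (if x == a.+1 :> nat then G (minn a c).+1 else
   if (x <= minn a c)%N then 'X * G (0 < x)%N else 0) : {poly R}).
  apply: eq_bigr => x _; rewrite -big_mkcond /=.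
  case: eqVneq => [E|_].
    rewrite E (eq_bigr (fun s : m.-tuple 'I_N =>
      'X^(weak_descents a.+1 (map (@nat_of_ord N) s)))).
      by rewrite IH ?minnSS //; lia.
    by move=> s _; rewrite ltnn.
  case: (leqP x (minn a c)) => [le_x|_]; last by apply: big1.
  rewrite (eq_bigr (fun s : m.-tuple 'I_N =>
     'X * 'X^(weak_descents x (map (@nat_of_ord N) s)))); last first.
    by move=> s _; rewrite (_ : (x <= a)%N = true) ?exprS //; lia.
  rewrite -mulr_sumr IH; try lia.
  by rewrite (_ : minn x 1 = (0 < x)%N) //; lia.
have lt_a1 : (a.+1 < N)%N by lia.
rewrite (bigD1 (Ordinal lt_a1)) //= eqxx.
rewrite (eq_bigr (fun x : 'I_N =>
  if (x <= minn a c)%N then 'X * G (0 < x)%N else 0)); last first.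
  by move=> x /eqP neq; case: eqVneq => // E; case: neq; apply: val_inj.
rewrite -big_mkcondr /=.
rewrite (eq_bigl (fun x : 'I_N => (x < (minn a c).+1)%N)); last first.
  by move=> x; rewrite ltnS -val_eqE /=; lia.
have le_N : ((minn a c).+1 <= N)%N by lia.
(* The letter 0 gives ['X * G 0], and each of the [minn a c] positive letters gives ['X * G 1]. *)
rewrite -(big_ord_widen N (fun x => 'X * G (0 < x)%N)) // big_ord_recl /=.
rewrite sumr_const card_ord (even_partS _ _ m) (odd_partS _ _ m) /G /=.
rewrite mulr1n mulr0n addr0 -!(mulr_natr (_ * _)) -natr1.
by ring.
Qed.

End DescentPoly.

(** * Peak-cliques of an area sequence *)

Section PeakEdges.
Variables (n : nat) (a : {ffun 'I_n -> 'I_n}).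

Definition area_word : seq nat := [seq nat_of_ord (a i) | i <- enum 'I_n].
Local Notation f := (nth 0 area_word).

Lemma size_area_word : size area_word = n.
Proof. by rewrite size_map size_enum_ord. Qed.

Lemma nth_area_word (i : 'I_n) : f i = a i.
Proof. by rewrite (nth_map i) ?size_enum_ord // nth_ord_enum. Qed.

(** The slope condition propagates the bound on the first entry to all the others. *)
Lemma area_seqP :
  reflect (f 0 = 0 /\ forall i, i.+1 < size area_word -> (f i.+1 <= (f i).+1))
    (area_seq a).
Proof.
apply: (iffP andP) => [[/forallP le_a /forallP slope]|[f0 slope]].
  split.
    have [n0|n_gt0] := posnP n; first by rewrite nth_default ?size_area_word ?n0.
    by have := le_a (Ordinal n_gt0); rewrite -nth_area_word /=; lia.
  rewrite size_area_word => i lt_i.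
  have /forallP/(_ (Ordinal lt_i)) := slope (Ordinal (ltnW lt_i)).
  by rewrite -!nth_area_word /= eqxx.
split; apply/forallP => i.
  by have := nth_slope (i := 0) (j := i) slope;
    rewrite size_area_word nth_area_word; have := ltn_ord i; lia.
apply/forallP => j; apply/implyP => /eqP E.
rewrite -!nth_area_word E; apply: slope.
by rewrite size_area_word -E ltn_ord.
Qed.

Definition peak_ends : {set 'I_n} :=
  [set j : 'I_n | (j.+1 == n) || (f j.+1 <= f j)].

Hypothesis area_a : area_seq a.

Let f0 : f 0 = 0. Proof. by have /area_seqP[] := area_a. Qed.

Let slope i : i.+1 < n -> f i.+1 <= (f i).+1.
Proof. by have /area_seqP[_ /(_ i)] := area_a; rewrite size_area_word. Qed.

Let slopes i j : i <= j < n -> f j <= f i + (j - i).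
Proof.
by have /area_seqP[_] := area_a; rewrite -size_area_word; exact: nth_slope.
Qed.

Let le_f i : i < n -> f i <= i.
Proof. by move=> lt_i; have := @slopes 0 i; rewrite f0; lia. Qed.

(** The leftmost vertex joined to [j] is [j - a j], so no extension to the left means [i = j - a j].
    Vertex [j.+1] reaches [i] exactly when the entry increases by 1, so no extension to the right
    means a weak descent or the last vertex. Isolated vertices are the case [a j = 0]. *)
Lemma is_peak_edgeE (i j : 'I_n) :
  is_peak_edge a (i, j) = (i + a j == j) && (j \in peak_ends).
Proof.
have lt_i := ltn_ord i; have lt_j := ltn_ord j.
rewrite inE -nth_area_word /is_peak_edge /uig_edge /=.
apply/idP/andP => [/orP[/andP[/eqP Eij /forallP noedge]|/and4P[lt_ij edge]]|].
- move: lt_j; rewrite -{j}Eij => _; split.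
    have [fi0|fi_gt0] := posnP (f i); first by rewrite fi0 addn0.
    have lt_pi : (i.-1 < n) by lia.
    have := noedge (Ordinal lt_pi); rewrite -!nth_area_word /=.
    by have := le_f lt_i; lia.
  have [//|neq] := eqVneq i.+1 n; have lt_Si : (i.+1 < n) by lia.
  have := noedge (Ordinal lt_Si); rewrite -!nth_area_word /=; lia.
- move: edge; rewrite -!nth_area_word => edge /forallP noS /forallP noP.
  have le_j : (j <= i + f j) by lia.
  have Ej : (i + f j = j).
    have [i0|i_gt0] := posnP i; first by have := le_f lt_j; lia.
    have lt_pi : (i.-1 < n) by lia.
    have := noP (Ordinal lt_pi); rewrite -!nth_area_word /=; lia.
  split; first by rewrite Ej.
  have [//|neq] := eqVneq j.+1 n; have lt_Sj : (j.+1 < n) by lia.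
  have := noS (Ordinal lt_Sj); rewrite -!nth_area_word /=; lia.
move=> [/eqP Ej endj].
have [Eij|neq] := eqVneq i j.
  apply/orP; left; apply/forallP => k; have lt_k := ltn_ord k.
  rewrite -!nth_area_word Eij; have fj0 : f j = 0 by rewrite Eij in Ej; lia.
  rewrite fj0; have [lt_jk|] := ltnP j k; last by lia.
  (* Here [f j.+1 = 0], and slopes of at most 1 keep every later vertex from reaching back to
     [j]. *)
  by have := @slopes j.+1 k; lia.
have lt_ij : i < j by rewrite ltn_neqAle neq; lia.
apply/orP; right; rewrite -!nth_area_word lt_ij /=.
apply/and3P; split; first by lia.
  by apply/forallP => k; have lt_k := ltn_ord k; apply/implyP => /eqP Ek;
    rewrite -!nth_area_word Ek; lia.
by apply/forallP => k; have lt_k := ltn_ord k; apply/implyP => /eqP Ek;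
  rewrite -!nth_area_word; lia.
Qed.

Definition peak_start (j : 'I_n) : 'I_n := insubd j (j - a j).

Lemma val_peak_start (j : 'I_n) : (peak_start j + a j) = j.
Proof.
have lt_j := ltn_ord j; have := le_f lt_j; rewrite nth_area_word => le_aj.
rewrite val_insubd; case: ifP; lia.
Qed.

Lemma peak_edgesE : peak_edges a = [set (peak_start j, j) | j in peak_ends].
Proof.
apply/setP => -[i j]; rewrite inE is_peak_edgeE.
apply/andP/imsetP => [[/eqP Ej endj]|[k endk [-> ->]]].
  exists j => //; congr pair; apply: val_inj; apply: (@addIn (a j)).
  by rewrite /= val_peak_start.
by rewrite val_peak_start.
Qed.

Lemma peakE : peak a = #|peak_ends|.
Proof. by rewrite /peak peak_edgesE card_imset // => i j []. Qed.

(** Cliques can be counted by their right ends, since the right end is the largest element of its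
    clique. *)
Lemma peak_nestingE (v : 'I_n) :
  peak_nesting a v = #|[set j in peak_ends | (j <= v + a j) && (v <= j)]|.
Proof.
pose C j := peak_clique (peak_start j, j).
have memC j k : (k \in C j) = ((j <= k + a j) && (k <= j)).
  by rewrite inE /=; have := val_peak_start j; lia.
have C_inj : injective C.
  move=> i j /setP E; apply: val_inj.
  have := E i; have := E j; rewrite !memC /=; lia.
rewrite /peak_nesting /peak_cliques peak_edgesE -imset_comp.
rewrite -(card_imset _ C_inj); congr #|pred_of_set _|.
apply/setP => A; rewrite inE.
apply/andP/imsetP => [[/imsetP[j endj ->] /=]|[j]].
  by rewrite -/(C j) memC => h; exists j; rewrite // inE endj.
by rewrite inE => /andP[endj h] ->; rewrite memC h imset_f.
Qed.

Lemma pnest_le2P : reflect (two_nested 1 area_word) (pnest a <= 2).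
Proof.
apply: (iffP (bigop.bigmax_leqP _ _ _)) => [le2|[_ _ three] v _].
  split; rewrite ?size_area_word.
  - exact: slope.
  - by move=> i j lt_ij _; rewrite addn1 ltnS le_f //; lia.
  move=> i j k lt_kji lt_i Dk Dj.
  rewrite ltnNge; apply/negP => overlap.
  (* The first weak descent from [i] on ends a peak-clique starting at [i - f i]. *)
  pose ramp_end l := [&& i <= l, l < n & (l.+1 == n) || (f l.+1 <= f l)].
  have ex_l : exists l, ramp_end l by exists n.-1; rewrite /ramp_end; lia.
  case: (ex_minnP ex_l) => l /and3P[le_il lt_l end_l] min_l.
  have ramp p : (i <= p <= l) -> f p = (f i + (p - i)).
    elim: p => [|p IHp] h; first by (have -> : i = 0 by lia); lia.
    have [<-|neq] := eqVneq i p.+1; first by lia.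
    have not_up : ~~ ramp_end p by apply/negP => /min_l; lia.
    have := @slope p; have := IHp; move: not_up; rewrite /ramp_end; lia.
  (* Left ends [p - f p] weakly increase with [p] and are constant along the ramp from [i] to [l].
     Hence the cliques ending at [j] and [l] start no later than [i - f i <= k], and all three
     contain [k]. *)
  have := ramp l; have := @slopes j i; have := @slopes k j => Hkj Hji Hl.
  have lt_j : (j < n) by lia.
  have lt_k : (k < n) by lia.
  pose K := Ordinal lt_k; pose J := Ordinal lt_j; pose L := Ordinal lt_l.
  have /= := le2 K isT; rewrite peak_nestingE leqNgt => /negP[].
  apply/card_gt2P; exists K, J, L; split; split.
  - by rewrite !inE -nth_area_word /=; lia.
  - by rewrite !inE -nth_area_word /=; lia.
  - by rewrite !inE -nth_area_word /=; lia.
  - by rewrite -val_eqE /=; lia.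
  - by rewrite -val_eqE /=; lia.
  - by rewrite -val_eqE /=; lia.
rewrite peak_nestingE leqNgt; apply/negP => /card_gt2P[x [y [z [[]]]]].
pose S (j : nat) := (j < n) /\ ((j.+1 == n) || (f j.+1 <= f j))
  /\ (j <= v + f j) /\ (v <= j).
have inS j : j \in [set j in peak_ends | (j <= v + a j) && (v <= j)] -> S j.
  by rewrite !inE -nth_area_word => /and3P[]; rewrite /S ltn_ord.
(* Of three right ends of cliques through [v], the first two are not the last vertex, hence weak
   descents, while the third clique starts at or before [v <= p]. *)
have noS p q r : (p < q < r) -> S p -> S q -> S r -> False.
  move=> lt_pqr [_ [Dp [_ le_vp]]] [_ [Dq _]] [lt_r [_ [le_r _]]].
  by have := three r q p; rewrite size_area_word; lia.
move=> /inS Sx /inS Sy /inS Sz [nxy nyz nzx].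
rewrite -!val_eqE /= in nxy nyz nzx.
have : x < y < z \/ x < z < y \/ y < x < z \/ y < z < x \/ z < x < y \/ z < y < x.
  by lia.
by move=> [|[|[|[|[|]]]]] /noS; apply.
Qed.

End PeakEdges.

(** The extra one is the last vertex, which always ends a peak-clique. *)
Lemma card_peak_ends (m x : nat) (a : {ffun 'I_m.+1 -> 'I_m.+1}) (s : seq nat) :
  area_word a = x :: s -> #|peak_ends a| = (weak_descents x s).+1.
Proof.
move=> Ew; have := size_area_word a; rewrite Ew => -[Em].
rewrite -sum1_card big_mkcond /= big_ord_recr /= inE eqxx /= addn1.
congr _.+1; rewrite weak_descentsE Em; apply: eq_bigr => i _.
by rewrite inE /= Ew eqSS ltn_eqF //=.
Qed.

(** * The peak polynomial for nesting at most 2 *)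

Section PeakPoly.
Local Open Scope ring_scope.

Lemma mem_peak_family2 (m x : nat) (a : {ffun 'I_m.+1 -> 'I_m.+1}) (s : seq nat) :
  area_word a = x :: s ->
  (a \in peak_family 2 m.+1) = (x == 0) && few_overlaps x 1 s.
Proof.
move=> Ew; rewrite inE; apply/andP/andP => [[area_a /(pnest_le2P area_a)]|].
  by rewrite Ew => /few_overlapsP; have /area_seqP[] := area_a; rewrite Ew => /= ->.
move=> [/eqP x0 /few_overlapsP]; rewrite -Ew => nested.
have area_a : area_seq a.
  by apply/area_seqP; case: nested => slope _ _; split=> //; rewrite Ew.
by split=> //; apply/pnest_le2P.
Qed.

(** The first entry is 0, and [minn 0 1 = 0] leaves only the even part; the factor ['X] is the peak
    at the last vertex. *)
Lemma peak_poly2E (m : nat) :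
  peak_poly 2 m.+1 = even_part 'X (1 + 'X) m * 'X.
Proof.
pose word (t : m.+1.-tuple 'I_m.+1) := [ffun i => tnth t i].
have word_bij : bijective word.
  exists (fun a : {ffun 'I_m.+1 -> 'I_m.+1} => [tuple a i | i < m.+1]) => [t|a].
    by apply: eq_from_tnth => i; rewrite tnth_mktuple ffunE.
  by apply/ffunP => i; rewrite ffunE tnth_mktuple.
have wordE t : area_word (word t) = map (@nat_of_ord _) t.
  rewrite /area_word -[in RHS](map_tnth_enum t) -map_comp; apply: eq_map => i.
  by rewrite /= ffunE.
have wordcE x (t : m.-tuple 'I_m.+1) :
  area_word (word [tuple of x :: t]) = nat_of_ord x :: map (@nat_of_ord _) t.
  exact: wordE.
rewrite /peak_poly (reindex word) /=; last exact: onW_bij.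
rewrite big_mkcond big_tuple_cons big_ord_recl /= [X in _ + X]big1 ?addr0.
  rewrite -big_mkcond /= mulrC.
  have := few_overlaps_gf int (N := m.+1) (m := m) (a := 0) (c := 1).
  rewrite min0n mulr0n addr0 => <- //; rewrite mulr_sumr.
  apply: eq_big => t; first by rewrite (mem_peak_family2 (wordcE _ _)).
  rewrite inE => /andP[area_t _].
  by rewrite (peakE area_t) (card_peak_ends (wordcE _ _)) exprS.
by move=> x _; apply: big1 => t _; rewrite (mem_peak_family2 (wordcE _ _)).
Qed.

End PeakPoly.

(** * Degree, symmetry and gamma expansion *)

Section GammaExpansion.
Local Open Scope ring_scope.
Variable R : comNzRingType.

Lemma coef_add1X_exp (k j : nat) : ((1 + 'X) ^+ k : {poly R})`_j = 'C(k, j)%:R.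
Proof.
rewrite addrC exprD1n; under eq_bigr do rewrite -scaler_nat.
rewrite -(poly_def _ (fun i => 'C(k, i)%:R)) coef_poly ltnS.
by case: leqP => // /bin_small ->.
Qed.

Lemma coef_even_part (m k : nat) :
  (even_part 'X (1 + 'X) m : {poly R})`_k
  = \sum_(i < m./2.+1 | (i <= k)%N) ('C(m, 2 * i) * 'C(m - 2 * i, k - i))%:R.
Proof.
rewrite coef_sum [RHS]big_mkcond; apply: eq_bigr => i _.
rewrite mulr_natl coefMn coefXnM ltnNge; case: leqP => _; last by rewrite mul0rn.
by rewrite /= coef_add1X_exp natrM mulr_natl.
Qed.

(** The summand of index [i] has degree at most [m - i], so the coefficient of degree [m] is 1, from
    [i = 0] alone. *)
Lemma size_even_part (m : nat) : size (even_part 'X (1 + 'X) m : {poly R}) = m.+1.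
Proof.
apply/eqP; rewrite eqn_leq; apply/andP; split.
  apply/leq_sizeP => j lt_mj; rewrite coef_even_part big1 // => i _.
  by rewrite [X in (_ * X)%N]bin_small ?muln0 //; have := ltn_ord i; lia.
rewrite ltnNge; apply/negP => /leq_sizeP/(_ m (leqnn m)) /eqP.
rewrite coef_even_part big_mkcond big_ord_recl /= big1 => [|i _].
  by rewrite muln0 bin0 !subn0 binn addr0 oner_eq0.
case: ifP => // _; rewrite [X in (_ * X)%N]bin_small ?muln0 //.
by have := ltn_ord i; rewrite /bump /=; lia.
Qed.

(** Each summand is symmetric about [m / 2], by the symmetry of the binomials of [m - 2 * i];
    out-of-range terms vanish on both sides. *)
Lemma symmetric_even_part (m : nat) :
  symmetric_poly (even_part 'X (1 + 'X) m : {poly R}).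
Proof.
rewrite /symmetric_poly /poly_deg size_even_part /=.
apply/polyP => k; rewrite coef_poly ltnS.
case: leqP => [le_km|lt_mk]; last by rewrite nth_default // size_even_part.
rewrite !coef_even_part big_mkcond [RHS]big_mkcond; apply: eq_bigr => i _.
have lt_i := ltn_ord i.
case: leqP => le_ik; case: leqP => le_imk //.
- have le_kim : (k - i <= m - 2 * i)%N by lia.
  by rewrite -(bin_sub le_kim); congr (_ * 'C(_, _))%:R; lia.
- by rewrite [X in (_ * X)%N]bin_small ?muln0 //; lia.
- by rewrite [X in (_ * X)%N]bin_small ?muln0 //; lia.
Qed.

Lemma gamma_even_part (m : nat) :
  is_gamma_poly (even_part 'X (1 + 'X) m : {poly R})
    (\poly_(i < m./2.+1) 'C(m, 2 * i)%:R).
Proof.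
rewrite /is_gamma_poly /poly_deg size_even_part /=; split; first exact: size_poly.
apply: eq_bigr => i _.
by rewrite coef_poly ltn_ord -mul2n mulr_natl scaler_nat.
Qed.

End GammaExpansion.

(** * Motzkin paths of height at most 1 *)

Section MotzkinCount.

Lemma card_tuple_cons (T : finType) (m : nat) (A : pred (m.+1.-tuple T)) :
  #|[set s | A s]|
  = \sum_(x : T) #|[set s : m.-tuple T | A [tuple of x :: s]]|.
Proof.
rewrite -sum1dep_card big_mkcond big_tuple_cons; apply: eq_bigr => x _.
by rewrite -sum1dep_card [RHS]big_mkcond.
Qed.

Lemma card_tuple0 (T : finType) (A : pred (0.-tuple T)) :
  #|[set s | A s]| = A [tuple].
Proof. by rewrite -sum1dep_card big_mkcond big_tuple0; case: (A _). Qed.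

Lemma big_motzkin_step (R : Type) (idx : R) (op : Monoid.com_law idx)
    (F : motzkin_step -> R) :
  \big[op/idx]_x F x = op (F Up) (op (F Down) (F Horiz)).
Proof.
rewrite (bigD1 Up) // (bigD1 Down) /=; last by apply/eqP.
rewrite (big_pred1 Horiz) // => x; apply/andP/eqP => [[/eqP nU /eqP nD]|->].
  by case: x nU nD.
by split; apply/eqP.
Qed.

(* Paths in the strip [0 <= y <= 1] that start at height [h] and end at 0. *)
Fixpoint low_path (h : bool) (s : seq motzkin_step) : bool :=
  match s with
  | [::] => ~~ h
  | Up :: s' => ~~ h && low_path true s'
  | Down :: s' => h && low_path false s'
  | Horiz :: s' => low_path h s'
  end.

Lemma path_y0 (s : seq motzkin_step) : path_y s 0 = 0%R.
Proof. by rewrite /path_y take0 big_nil. Qed.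

Lemma path_yS (x : motzkin_step) (s : seq motzkin_step) (k : nat) :
  path_y (x :: s) k.+1 = (step_dy x + path_y s k)%R.
Proof. by rewrite /path_y /= big_cons. Qed.

(** An arbitrary starting height lets the induction apply to the path left after one step. *)
Lemma low_pathP (h : bool) (s : seq motzkin_step) :
  reflect ((forall k : nat, (k <= size s)%N -> 0 <= h%:Z + path_y s k <= 1)%R
           /\ (h%:Z + path_y s (size s) = 0)%R)
    (low_path h s).
Proof.
elim: s h => [|x s IH] h /=.
  apply: (iffP idP) => [h0|[_]]; last by rewrite path_y0; case: h.
  by case: h h0 => // _; split=> [[|k]|] //; rewrite path_y0.
have step (h' : bool) : (h%:Z + step_dy x = h'%:Z)%R ->
  reflect ((forall k : nat, (k <= (size s).+1)%N ->
            0 <= h%:Z + path_y (x :: s) k <= 1)%R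
           /\ (h%:Z + path_y (x :: s) (size s).+1 = 0)%R)
    (low_path h' s).
  move=> Eh; apply: (iffP (IH h')) => -[bd last0]; split.
  - case=> [|k] le_k; first by rewrite path_y0 addr0; case: (h).
    by rewrite path_yS addrA Eh bd.
  - by rewrite path_yS addrA Eh.
  - by move=> k le_k; have := bd k.+1 le_k; rewrite path_yS addrA Eh.
  - by rewrite -last0 path_yS addrA Eh.
(* A step leaving the strip already breaks the bounds at the point of index 1. *)
have out : (h%:Z + step_dy x < 0)%R || (1 < h%:Z + step_dy x)%R ->
    ~ ((forall k : nat, (k <= (size s).+1)%N ->
            0 <= h%:Z + path_y (x :: s) k <= 1)%R
       /\ (h%:Z + path_y (x :: s) (size s).+1 = 0)%R).
  move=> lt_out [/(_ 1 isT)]; rewrite path_yS path_y0 addr0; lia.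
by case: x step out => step out; case: h step out => step out /=;
  try (by apply: step); right; apply: out.
Qed.

Lemma motzkin_path_height1 (m : nat) (s : m.-tuple motzkin_step) :
  motzkin_path s && (path_height s <= 1)%R = low_path false s.
Proof.
apply/andP/low_pathP; rewrite size_tuple.
  case=> /andP[/forallP ge0 /eqP last0] /Order.TotalTheory.bigmax_leP[_ le1].
  split=> [k le_k|]; last by rewrite add0r.
  have := ge0 (inord k); have := le1 (inord k) isT.
  by rewrite inordK // add0r => -> ->.
case=> bd; rewrite add0r => E; rewrite /motzkin_path E eqxx andbT; split.
  by apply/forallP => k; have := bd k (leq_ord k); rewrite add0r => /andP[].
apply/Order.TotalTheory.bigmax_leP; split=> // k _.
by have := bd k (leq_ord k); rewrite add0r => /andP[].
Qed.

(** Up and down steps alternate, so a path is determined by the positions of its [2 * i + h]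
    non-horizontal steps. In the induction, a horizontal first step and a height-changing one give
    the two terms of Pascal's rule. *)
Lemma card_low_path (m i : nat) (h : bool) :
  #|[set s : m.-tuple motzkin_step | low_path h s && (count_mem Up s == i)]|
  = 'C(m, 2 * i + h).
Proof.
have DU : (Down == Up) = false by apply/eqP.
have HU : (Horiz == Up) = false by apply/eqP.
elim: m i h => [|m IH] i h.
  by rewrite card_tuple0 bin0n addn_eq0 muln_eq0; case: h; case: i.
rewrite card_tuple_cons big_motzkin_step /= eqxx DU HU.
case: h; rewrite /= ?addn0 ?addn1 ?binS.
  rewrite (eq_card0 (A := [set _ | false])) ?add0n; last by move=> s; rewrite inE.
  by rewrite (IH i false) (IH i true) addn0 addn1 addnC.
rewrite (eq_card0 (A := [set s : m.-tuple _ | false])) ?add0n; last first.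
  by move=> s; rewrite inE.
case: i => [|i].
  rewrite eq_card0 ?IH ?bin0 // => s; rewrite inE; exact: andbF.
rewrite (eq_card (B := [set s : m.-tuple _ |
  low_path true s && (count_mem Up s == i)])).
  by rewrite !IH mulnS addn0 addn1 binS addnC.
by move=> s; rewrite !inE add1n eqSS.
Qed.

End MotzkinCount.

(** * Motzkin sequences with entries at most 2 *)

Section MotzkinSeqCount.

Definition low_entries (v : nat) (s : seq nat) : bool :=
  all (fun x => 0 < x <= 2) s && (last v s == 1).

Lemma ascents_cons (n v x : nat) (s : seq nat) :
  ascents n.+2 [:: v, x & s] = (v < x) + ascents n.+1 (x :: s).
Proof.
rewrite /ascents -!sum1dep_card big_mkcond [in RHS]big_mkcond big_ord_recl /=.
by case: (v < x).
Qed.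

(** As for paths, the [2 * i + h] places where the entry changes determine the sequence. The
    hypothesis puts the letter 2 in the alphabet as soon as there is a letter to choose; sequences
    of size 1 have entries in ['I_2]. *)
Lemma card_low_entries (N m i : nat) (h : bool) : (0 < m -> 2 < N) ->
  #|[set s : m.-tuple 'I_N |
      low_entries h.+1 (map (@nat_of_ord N) s)
      && (ascents m.+1 (h.+1 :: map (@nat_of_ord N) s) == i)]|
  = 'C(m, 2 * i + h).
Proof.
elim: m i h => [|m IH] i h big_N.
  rewrite card_tuple0 bin0n addn_eq0 muln_eq0 /low_entries /ascents.
  by rewrite (eq_card0 (A := [set _ | _])); [case: h; case: i|case].
have gt2N := big_N isT; have lt1 : 1 < N by lia.
rewrite card_tuple_cons (bigD1 (Ordinal lt1)) // (bigD1 (Ordinal gt2N)) //=.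
rewrite [X in _ + (_ + X)]big1 ?addn0 => [|x /andP[]]; last first.
  rewrite -!val_eqE /= => n1 n2; apply: eq_card0 => s; rewrite !inE /low_entries /=.
  by rewrite (_ : (0 < x <= 2) = false) //; lia.
(* Here [j] is the number of ascents left after moving from [h.+1] to [g.+1]. *)
have Ecard (g : bool) (lt_g : g.+1 < N) j :
  (forall k, ((h < g) + k == i) = (k == j)) ->
  #|[set s : m.-tuple 'I_N |
      low_entries h.+1 (map (@nat_of_ord N) (Ordinal lt_g :: s))
      && (ascents m.+2 (h.+1 :: map (@nat_of_ord N) (Ordinal lt_g :: s)) == i)]|
  = 'C(m, 2 * j + g).
  move=> Ej; rewrite -IH //; apply: eq_card => s; rewrite !inE /= ascents_cons.
  by rewrite Ej /low_entries /=; case: (g).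
rewrite (Ecard false lt1 i) => [|k]; last by case: (h).
case: h Ecard => Ecard; last case: i Ecard => [|i] Ecard.
- by rewrite (Ecard true gt2N i) // addn0 addn1 binS addnC.
- rewrite eq_card0 ?bin0 // => s; rewrite inE /= ascents_cons; exact: andbF.
- by rewrite (Ecard true gt2N i) // addn0 addn1 mulnS binS addnC.
Qed.

(** Two entries from 1 and 2 differ by at most 1, which yields the step condition. *)
Lemma motzkin_seq_low (m v : nat) (s : seq nat) : size s = m ->
  motzkin_seq m.+1 (v :: s) && (largest_entry (v :: s) <= 2)
  = (v == 1) && low_entries v s.
Proof.
move=> <-; have lastE : nth 0 (v :: s) (size s) = last v s.
  exact: (nth_last 0 (v :: s)).
rewrite /motzkin_seq /low_entries /= lastE eqxx /=.
have -> : (largest_entry (v :: s) <= 2) = all (fun x => x <= 2) (v :: s).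
  rewrite /largest_entry; apply/bigmax_leqP_seq/allP => le2 x.
    by move=> x_in; apply: le2.
  by move=> x_in _; apply: le2.
case: (v =P 1) => [->|_]; last by rewrite !andbF.
rewrite /= (@all_predI _ (fun x => 0 < x) (fun x => x <= 2)).
case: (boolP (all (fun x => 0 < x) s)) => //= pos.
case: (_ == 1) => //=; rewrite ?andbF // andbT andb_idl // => le2.
apply/forallP => i.
have low k : k < (size s).+1 -> 0 < nth 0 (1 :: s) k <= 2.
  case: k => //= k; rewrite ltnS => lt_k.
  by rewrite (allP pos) ?(allP le2) ?mem_nth.
have := low i; have := low i.+1; have := ltn_ord i; rewrite /=; lia.
Qed.

Lemma card_low_motzkin_seqs (m i : nat) :
  #|[set w in motzkin_seqs m.+1 |
      (ascents m.+1 (map val w) == i) && (largest_entry (map val w) <= 2)]|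
  = 'C(m, 2 * i).
Proof.
rewrite card_tuple_cons (bigD1 (Ordinal (isT : 1 < m.+2))) //= big1 ?addn0.
  rewrite -[in RHS](addn0 (2 * i)) -(@card_low_entries m.+2 _ _ false) //.
  apply: eq_card => s; rewrite !inE /= andbCA andbC.
  by rewrite motzkin_seq_low ?size_map ?size_tuple.
move=> x; rewrite -val_eqE /= => n1; apply: eq_card0 => s; rewrite !inE /=.
by rewrite andbCA motzkin_seq_low ?size_map ?size_tuple // (negPf n1) andbF.
Qed.

End MotzkinSeqCount.

(** * Closed form and conclusion *)

Local Open Scope ring_scope.

(** The odd parts of [(1 + s) ^+ m] and [(1 - s) ^+ m] cancel in the sum, leaving twice the even
    part at [y = 1]. *)
Lemma horner_binomial_poly (R : comUnitRingType) (m : nat) (s : R) :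
  (2%:R : R) \is a GRing.unit ->
  (map_poly intr (\poly_(i < m./2.+1) 'C(m, 2 * i)%:R : {poly int})).[s ^+ 2]
  = ((1 + s) ^+ m + (1 - s) ^+ m) / 2%:R.
Proof.
move=> unit2; apply: (canRL (mulrK unit2)).
rewrite binomial_even_odd (binomial_even_odd (- s)) sqrrN.
rewrite (_ : _.[_] = even_part (s ^+ 2) 1 m); first by ring.
rewrite poly_def rmorph_sum horner_sum; apply: eq_bigr => i _.
rewrite /= linearZ /= map_polyXn hornerZ hornerXn expr1n mulr1.
by rewrite rmorph_nat.
Qed.

Theorem proposition5p10 (n : nat) (hn : (1 <= n)%N) :
  let P : {poly int} := peak_poly 2 n %/ 'X in
  let g : {poly int} :=
    \sum_(0 <= i < ((n - 1) %/ 2).+1) ('C(n - 1, 2 * i))%:R *: 'X^i in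
  [/\ [/\ peak_poly 2 n = P * 'X, symmetric_poly P & is_gamma_poly P g],
      (forall (R : comUnitRingType) (t sqrt_t : R),
         (2%:R : R) \is a GRing.unit -> sqrt_t ^+ 2 = t ->
         (map_poly intr g).[t]
         = ((1 + sqrt_t) ^+ (n - 1) + (1 - sqrt_t) ^+ (n - 1)) / 2%:R),
      (forall i : nat,
         'C(n - 1, 2 * i)
         = #|[set s : (n - 1).-tuple motzkin_step |
               [&& motzkin_path s, up_steps s == i & path_height s <= 1]]|)
    & (forall i : nat,
         'C(n - 1, 2 * i)
         = #|[set w in motzkin_seqs n |
               (ascents n (map val w) == i)
               && (largest_entry (map val w) <= 2)%N]|)].
Proof.
case: n hn => // m _ P g; rewrite !subn1 /= in g *.
have Eg : g = \poly_(i < m./2.+1) 'C(m, 2 * i)%:R.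
  by rewrite /g poly_def divn2 big_mkord.
have EP : P = even_part 'X (1 + 'X) m.
  by rewrite /P peak_poly2E Pdiv.IdomainMonic.mulpK ?monicX.
split.
- rewrite EP Eg; split; [exact: peak_poly2E | exact: symmetric_even_part |].
  exact: gamma_even_part.
- by move=> R t s unit2 <-; rewrite Eg horner_binomial_poly.
- move=> i; rewrite -[in LHS](addn0 (2 * i)%N) -(card_low_path m i false).
  apply: eq_card => s; rewrite !inE andbCA andbC.
  by rewrite motzkin_path_height1.
- by move=> i; rewrite card_low_motzkin_seqs.
Qed.
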